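(* There exists a precompact, reflexive topological abelian group which is of the first category.
   Context: A topological group is precompact if it is topologically isomorphic to a dense subgroup of a compact (Hausdorff) topological group. A topological group is of the first category if it can be covered by countably many nowhere dense subsets (of itself). $\mathbb{T}$ is the circle group $\{z\in\mathbb{C}:|z|=1\}$ with its usual compact topology. For a topological abelian group $G$, let $G^\wedge$ denote the group of all continuous homomorphisms $G\to\mathbb{T}$ under pointwise multiplication, endowed with the compact-open topology. $G$ is reflexive (in the sense of Pontryagin duality) if the canonical evaluation mapping $G\to (G^\wedge)^\wedge$, $x\mapsto(\chi\mapsto\chi(x))$, is a topological isomorphism onto $(G^\wedge)^\wedge$. *)

(* Defs.v *)
From HB Require Import structures.
From mathcomp Require Import all_boot all_order all_algebra.
From mathcomp Require Import complex.
From mathcomp Require Import all_classical all_reals.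
From mathcomp Require Import topology normedtype.

Set Implicit Arguments.
Unset Strict Implicit.
Unset Printing Implicit Defensive.

Import Order.TTheory GRing.Theory Num.Theory.
Import numFieldNormedType.Exports.

Local Open Scope classical_set_scope.
Local Open Scope complex_scope.
Local Open Scope ring_scope.

Record circle (R : realType) : Type := Circle {
  circle_val : R[i];
  circle_norm : `|circle_val| = 1
}.

Section circle_group.
Variable R : realType.
Local Notation T := (circle R).
Local Notation v := (@circle_val R).

Lemma circle_val_inj : injective v.
Proof.
by move=> [x hx] [y hy] /= xy; subst y; congr Circle; exact: Prop_irrelevance.
Qed.

Lemma circle_val_neq0 (x : T) : v x != 0.
Proof. by rewrite -normr_eq0 circle_norm oner_eq0. Qed.

HB.instance Definition _ := gen_eqMixin T.
HB.instance Definition _ := gen_choiceMixin T.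
(* [R[i]^o] is the field R[i] with the topology of its norm. *)
HB.instance Definition _ :=
  Uniform.copy T (initial_topology (v : T -> R[i]^o)).

Let inv_norm (x : T) : `|(v x)^-1| = 1.
Proof. by rewrite normfV circle_norm invr1. Qed.
Let mul_norm (x y : T) : `|v x * v y| = 1.
Proof. by rewrite normrM !circle_norm mulr1. Qed.

Definition circle_one : T := Circle (normr1 R[i]).
Definition circle_inv (x : T) : T := Circle (inv_norm x).
Definition circle_mul (x y : T) : T := Circle (mul_norm x y).

Let mulA : associative circle_mul.
Proof. by move=> x y z; apply: circle_val_inj; exact: mulrA. Qed.
Let mulC : commutative circle_mul.
Proof. by move=> x y; apply: circle_val_inj; exact: mulrC. Qed.
Let mul1 : left_id circle_one circle_mul.
Proof. by move=> x; apply: circle_val_inj; exact: mul1r. Qed.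
Let mulV : left_inverse circle_one circle_inv circle_mul.
Proof. by move=> x; apply: circle_val_inj; exact/mulVf/circle_val_neq0. Qed.

(* MathComp's abelian groups are additive: [x + y] in [circle R] is the
   complex product, [- x] the complex inverse and [0] is [1]. *)
HB.instance Definition _ := GRing.isZmodule.Build T mulA mulC mul1 mulV.

Lemma circle_valB (x y : T) : v (x - y) = v x / v y.
Proof. by []. Qed.

Lemma circle_entourageP (E : set (T * T)) :
  entourage E <-> exists2 e : R[i], 0 < e &
    forall x y : T, `|v x - v y| < e -> E (x, y).
Proof.
split.
  move=> [V]; rewrite -entourage_ballE => -[e /= e0 eV] VE.
  by exists e => // x y xy; apply: VE; exact: eV.
move=> [e e0 eE]; exists [set p : R[i]^o * R[i]^o | ball p.1 e p.2].
  by rewrite -entourage_ballE; exists e.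
by move=> [x y] /=; exact: eE.
Qed.

Lemma circle_sub_dist (x y x' y' : T) :
  `|v (x - y) - v (x' - y')| <= `|v x - v x'| + `|v y - v y'|.
Proof.
have -> : `|v y - v y'| = `|(v y)^-1 - (v y')^-1|.
  have -> : (v y)^-1 - (v y')^-1 = (v y' - v y) * ((v y)^-1 * (v y')^-1).
    rewrite mulrBl mulrCA mulfV ?circle_val_neq0// mulr1.
    by rewrite mulrA mulfV ?circle_val_neq0// mul1r.
  by rewrite normrM normrM !normfV !circle_norm invr1 !mulr1 distrC.
rewrite !circle_valB.
have -> : v x / v y - v x' / v y' =
    (v x - v x') / v y + v x' * ((v y)^-1 - (v y')^-1).
  by rewrite mulrBl mulrBr addrA subrK.
rewrite (le_trans (ler_normD _ _))// !normrM normfV !circle_norm.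
by rewrite invr1 mulr1 mul1r.
Qed.

Lemma circle_sub_entourage (E : set (T * T)) : entourage E ->
  exists2 E' : set (T * T), entourage E' & forall x y x' y' : T,
    E' (x, x') -> E' (y, y') -> E (x - y, x' - y').
Proof.
move=> /circle_entourageP[e e0 eE].
exists [set p : T * T | `|v p.1 - v p.2| < e / 2].
  by apply/circle_entourageP; exists (e / 2) => //; rewrite divr_gt0.
move=> x y x' y' /= xx' yy'; apply: eE.
by rewrite (le_lt_trans (circle_sub_dist _ _ _ _))// [ltRHS]splitr ltrD.
Qed.

Let circle_sub_continuous : continuous (fun x : T * T => x.1 - x.2).
Proof.
move=> [x y]; apply/(cvg_app_entourageP (fun x : T * T => x.1 - x.2)) => E /circle_sub_entourage[E' entE' EE'].
exists (xsection E' x, xsection E' y) => /=.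
  by split; exact: nbhs_entourage.
by move=> [x' y'] /= [/xsectionP ? /xsectionP ?]; exact: EE'.
Qed.

HB.instance Definition _ :=
  PreTopologicalNmodule_isTopologicalZmodule.Build T circle_sub_continuous.
HB.instance Definition _ := isPointed.Build T 0.

End circle_group.

(* Continuous homomorphisms into the circle; the group law given below is
   pointwise, i.e. the product of characters is written [f + g]. *)
Record character (R : realType) (G : topologicalZmodType) : Type := Character {
  character_fun :> G -> circle R;
  characterD : {morph character_fun : x y / x + y};
  character_continuous : continuous character_fun
}.

Section dual_group.
Variables (R : realType) (G : topologicalZmodType).
Local Notation T := (circle R).
Local Notation dual := (character R G).

Lemma character_ext (f g : dual) : f =1 g -> f = g.
Proof.
move: f g => [f fD fc] [g gD gc] /= /funext fg; subst g.
by congr Character; exact: Prop_irrelevance.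
Qed.

HB.instance Definition _ := gen_eqMixin dual.
HB.instance Definition _ := gen_choiceMixin dual.
HB.instance Definition _ := Topological.copy dual
  (initial_topology (fun f : dual => (f : {compact-open, G -> T}))).

Lemma character_sub_morph (f g : dual) :
  {morph (fun x => f x - g x) : x y / x + y}.
Proof. by move=> x y; rewrite !characterD opprD addrACA. Qed.

Lemma character_sub_continuous (f g : dual) :
  continuous (fun x => f x - g x).
Proof.
move=> x; apply: (@continuous_comp _ _ _ (fun x => (f x, g x))
  (fun z : T * T => z.1 - z.2)); last exact: sub_continuous.
exact: (cvg_pair (@character_continuous _ _ f x) (@character_continuous _ _ g x)).
Qed.

Let zero_morph : {morph (fun _ : G => 0 : T) : x y / x + y}.
Proof. by move=> x y; rewrite addr0. Qed.

Definition character_zero : dual :=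
  Character zero_morph (fun x => cvg_cst (0 : T)).
Definition character_sub (f g : dual) : dual :=
  Character (@character_sub_morph f g) (@character_sub_continuous f g).
Definition character_opp (f : dual) : dual := character_sub character_zero f.
Definition character_add (f g : dual) : dual :=
  character_sub f (character_opp g).

Lemma character_addE (f g : dual) x : character_add f g x = f x + g x.
Proof. by rewrite /= sub0r opprK. Qed.
Lemma character_oppE (f : dual) x : character_opp f x = - f x.
Proof. exact: sub0r. Qed.

Let addA : associative character_add.
Proof.
by move=> f g h; apply: character_ext => x; rewrite !character_addE addrA.
Qed.
Let addC : commutative character_add.
Proof.
by move=> f g; apply: character_ext => x; rewrite !character_addE addrC.
Qed.
Let add0 : left_id character_zero character_add.
Proof. by move=> f; apply: character_ext => x; rewrite character_addE add0r. Qed.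
Let addN : left_inverse character_zero character_opp character_add.
Proof.
move=> f; apply: character_ext => x.
by rewrite character_addE character_oppE addNr.
Qed.

HB.instance Definition _ := GRing.isZmodule.Build dual addA addC add0 addN.

Lemma characterBE (f g : dual) x : (f - g) x = f x - g x.
Proof. by rewrite -character_oppE -character_addE. Qed.

Lemma character_near (f : dual) (K : set G) (E : set (T * T)) :
  compact K -> entourage E ->
  \forall h \near f, forall x, K x -> E (f x, (h : dual) x).
Proof.
move=> cK entE.
pose F : set_system (G -> T) := (fun h : dual => (h : G -> T)) @ nbhs f.
have FF : Filter F by exact: fmap_filter.
have cf : {compact-open, F --> (f : G -> T)}.
  exact: (@initial_continuous dual {compact-open, G -> T}).
have := (compact_open_fam_compactP (@character_continuous R G f) FF).1 cf.
move=> /(fam_cvgP _ _ FF).1 /(_ K cK) cfK.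
apply: (cfK [set h | forall x, K x -> E (f x, h x)]).
by apply/uniform_nbhs; exists E; split.
Qed.

Let dual_sub_continuous : continuous (fun p : dual * dual => p.1 - p.2).
Proof.
apply: (@continuous_comp_initial dual (dual * dual)%type {compact-open, G -> T}).
move=> [f g].
apply/(compact_open_fam_compactP (@character_continuous R G (f - g)) _).
apply/(fam_cvgP (@compact G) _ _) => K cK A /uniform_nbhs[E [entE EA]].
have [E' entE' EE'] := circle_sub_entourage entE.
exists ([set h : dual | forall x, K x -> E' (f x, h x)],
        [set h : dual | forall x, K x -> E' (g x, h x)]).
  by split; exact: character_near.
move=> [f' g'] /= [f'P g'P]; apply: EA => x Kx.
by have := EE' _ _ _ _ (f'P x Kx) (g'P x Kx); rewrite -!characterBE.
Qed.

HB.instance Definition _ :=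
  PreTopologicalNmodule_isTopologicalZmodule.Build dual dual_sub_continuous.

End dual_group.

Section evaluation.
Variables (R : realType) (G : topologicalZmodType).

Let eval_morph (x : G) :
  {morph (fun f : character R G => f x) : f g / f + g}.
Proof. by move=> f g; exact: character_addE. Qed.

Let eval_continuous (x : G) : continuous (fun f : character R G => f x).
Proof.
move=> f; have Ff : Filter (nbhs f) := nbhs_filter f.
apply/(cvg_app_entourageP (fun h : character R G => h x) Ff) => E entE.
have /= := character_near f (@compact_set1 G x) entE.
by apply: filterS => h; apply.
Qed.

Definition evaluation (x : G) : character R (character R G) :=
  Character (@eval_morph x) (@eval_continuous x).

End evaluation.

Definition homeomorphism (X Y : topologicalType) (f : X -> Y) : Prop :=
  continuous f /\
  exists g : Y -> X, [/\ cancel f g, cancel g f & continuous g].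

Definition topological_isomorphism (G H : topologicalZmodType) (f : G -> H) :
    Prop :=
  {morph f : x y / x + y} /\ homeomorphism f.

Definition reflexive_group (R : realType) (G : topologicalZmodType) : Prop :=
  topological_isomorphism (@evaluation R G).

HB.mixin Record isTopologicalGroup K & Topological K & Group K := {
  mulg_continuous : continuous (fun z : K * K => (z.1 * z.2)%g);
  invg_continuous : continuous (fun x : K => (x^-1)%g)
}.

#[short(type="topologicalGroupType")]
HB.structure Definition TopologicalGroup :=
  {K of Topological K & Group K & isTopologicalGroup K}.

(* K is a general compact group, hence multiplicative notation on its side;
   H is viewed as a type with its subspace topology. *)
Definition precompact_group (G : topologicalZmodType) : Prop :=
  exists (K : topologicalGroupType) (H : set K) (f : G -> H),
    [/\ compact [set: K] /\ hausdorff_space K,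
        group_closed (mem H) /\ dense H,
        forall x y : G, \val (f (x + y)) = (\val (f x) * \val (f y))%g &
        homeomorphism f].

Definition nowhere_dense (X : topologicalType) (A : set X) : Prop :=
  interior (closure A) = set0.

Definition first_category (X : topologicalType) : Prop :=
  exists A : nat -> set X,
    (forall n, nowhere_dense (A n)) /\ \bigcup_n A n = [set: X].

(* Main.v *)
Require Import Defs.
From HB Require Import structures.
From mathcomp Require Import all_boot all_order all_algebra.
From mathcomp Require Import complex zify.
From mathcomp Require Import all_classical all_reals topology normedtype.

Set Implicit Arguments.
Unset Strict Implicit.
Unset Printing Implicit Defensive.

Import Order.TTheory GRing.Theory Num.Theory.
Import numFieldNormedType.Exports.

Local Open Scope classical_set_scope.
Local Open Scope ring_scope.

(** The group is Boolean, hence a vector space over F_2, and it is built as a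
    dense subgroup of a Cantor cube [tree -> bool].  So it is precompact, and its
    characters are the finite sums of coordinates.

    Reflexivity.  If neither a Boolean group whose topology is given by characters
    nor its dual has an infinite compact subset, then both dual topologies are
    topologies of pointwise convergence.  A character of the dual is then trivial
    on the common kernel of finitely many evaluations, so it is a sum of some of
    them, and the evaluation is an isomorphism ([boolean_reflexive]).

    To exclude infinite compact sets, every infinite subset of a Boolean group
    contains a sequence such that any point [y] is told apart from almost all
    terms by a single homomorphism to F_2 ([xor_morph_escape]).  If that
    homomorphism can be realized, on the countably many elements involved, by a
    continuous one, then the sequence has no cluster point
    ([compact_escape]).  So what is needed is a pairing that is rich enough for
    countable sets on both sides.  The inductive type [tree] provides it without
    transfinite recursion: a node prescribes its own pairing with countably many
    subtrees, and well-foundedness keeps these prescriptions consistent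
    ([incidence_child], [incidence_parent]).

    First category.  A pairing that realizes every homomorphism on every countable
    subgroup of the dual would make the group a Baire space.  Therefore the
    countably many leaf coordinates are treated apart: on them, the elements of
    the group form a meagre group of sparse sequences, those with
    at most [c * n.+1] ones below [2 ^ n] for some constant [c].  The sets with
    [c] fixed are nowhere dense ([leaf_sparse_thin]), which gives the first
    category.  Yet every infinite set of naturals contains an infinite subset all
    of whose subsets are sparse, and this still suffices to exclude infinite
    compact sets of characters that differ in leaves only ([triangular_solution]).
    The sparse sequences must not form a direct factor, because they contain
    convergent sequences; the node coordinates see them through arbitrary
    functionals, and so destroy all infinite compact sets of the group
    ([twisted_countable_coordinate]). *)

(** * Boolean groups and their homomorphisms to F_2 *)

Definition boolean_group (V : zmodType) := forall x : V, x + x = 0.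

Definition xor_morph (V : zmodType) (h : V -> bool) :=
  {morph h : x y / x + y >-> x (+) y}.

Section BooleanGroup.
Variables (V : zmodType) (V2 : boolean_group V).
Implicit Types (x y : V) (L : seq V) (s : nat -> V).

Lemma booladdK x y : x + y + y = x.
Proof. by rewrite -addrA V2 addr0. Qed.

Lemma booladdKl x y : x + (x + y) = y.
Proof. by rewrite addrA V2 add0r. Qed.

Lemma xor_morph0 (h : V -> bool) : xor_morph h -> h 0 = false.
Proof. by move=> hD; rewrite -[0](V2 0) hD addbb. Qed.

(** A subgroup maximal among those that contain [U] but not [a] has index two:
    [a] lies in its join with any outside element.  Its complement is the
    required homomorphism. *)
Lemma xor_morph_separation (U : set V) a :
  U 0 -> (forall x y, U x -> U y -> U (x + y)) -> ~ U a ->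
  exists h : V -> bool,
    [/\ xor_morph h, forall u, U u -> h u = false & h a].
Proof.
move=> U0 UD Ua.
(* The clause on nonempty sets makes the union of the empty chain admissible. *)
pose P (A : set V) := [/\ forall x y, A x -> A y -> A (x + y), ~ A a &
  A !=set0 -> U `<=` A].
have [A [[AD Aa AU] Amax]] : exists A, P A /\ forall B, A `<` B -> ~ P B.
  apply: Zorn_bigcup => F FP Ftot; split.
  - move=> x y [A FA Ax] [B FB By].
    have [AB|BA] := Ftot _ _ FA FB.
      by exists B => //; have [+ _ _] := FP _ FB; apply=> //; exact: AB.
    by exists A => //; have [+ _ _] := FP _ FA; apply=> //; exact: BA.
  - by move=> [A FA Aa]; have [_ + _] := FP _ FA; apply.
  - move=> [x [A FA Ax]] u Uu; exists A => //.
    by have [_ _] := FP _ FA; apply=> //; exists x.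
have {}AU : U `<=` A.
  apply: AU; apply: contrapT => /set0P/negP/negPn/eqP A0.
  have AsubU : A `<` U by rewrite A0; split=> [x []//|/(_ _ U0)].
  by apply: (Amax U AsubU); split=> // _ u.
have A0 : A 0 by exact: AU.
have idx2 x : ~ A x -> A (x + a).
  move=> Ax; pose B := [set z | A z \/ A (z + x)].
  have AB : A `<` B.
    split; first by move=> z Az; left.
    by move=> /(_ x); apply: (contra_not _ Ax); apply; right; rewrite V2.
  apply: contrapT => Axa; apply: (Amax B AB); split.
  - move=> y z [Ay|Ay] [Az|Az].
    + by left; exact: AD.
    + by right; rewrite -addrA; exact: AD.
    + by right; rewrite addrAC; exact: AD.
    + by left; have := AD _ _ Ay Az; rewrite addrACA V2 addr0.
  - by move=> [//|]; rewrite addrC.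
  - by move=> _ u Uu; left; exact: AU.
exists (fun x => ~~ `[< A x >]); split; last exact/asboolPn.
  move=> x y; case: (asboolP (A x)) => Ax; case: (asboolP (A y)) => Ay /=.
  - by apply/negPn/asboolP; exact: AD.
  - apply/asboolPn => Axy; apply: Ay.
    by rewrite -(booladdKl x y); exact: AD.
  - apply/asboolPn => Axy; apply: Ax.
    by rewrite -(booladdK x y); exact: AD.
  - apply/negPn/asboolP.
    by have := AD _ _ (idx2 _ Ax) (idx2 _ Ay); rewrite addrACA V2 addr0.
by move=> u Uu; apply/negbTE/negPn/asboolP; exact: AU.
Qed.

(** When [L] enumerates a subgroup, this enumerates the subgroup generated by
    [L] and the first [k] terms of [s]. *)
Fixpoint span_seq L s k : seq V :=
  if k is k'.+1 then
    span_seq L s k' ++ [seq x + s k' | x <- span_seq L s k']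
  else L.

Lemma mem_shift L x a : x \in L -> x + a \in [seq z + a | z <- L].
Proof. exact: (map_f (fun z => z + a)). Qed.

Definition add_closed L := forall x y, x \in L -> y \in L -> x + y \in L.

Lemma span_seq_closed L s k : add_closed L -> add_closed (span_seq L s k).
Proof.
move=> LD; elim: k => //= k IH x y; rewrite !mem_cat.
move=> /orP[xL|/mapP[x' xL ->]] /orP[yL|/mapP[y' yL ->]].
- by rewrite IH.
- by rewrite addrA mem_shift ?orbT// IH.
- by rewrite addrAC mem_shift ?orbT// IH.
- by rewrite addrACA V2 addr0 IH.
Qed.

Lemma span_seq_le L s k l : (k <= l)%N -> {subset span_seq L s k <= span_seq L s l}.
Proof.
move=> /subnK <-; elim: (l - k)%N => //= d IH x xL.
by rewrite mem_cat IH.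
Qed.

Lemma pair_closed y : add_closed [:: 0; y].
Proof.
move=> a b; rewrite !inE => /orP[]/eqP-> /orP[]/eqP->;
by rewrite ?addr0 ?add0r ?V2 ?eqxx ?orbT.
Qed.

Lemma infinite_independent (K : set V) : infinite_set K ->
  exists s, (forall k, K (s k)) /\ forall k, s k \notin span_seq [:: 0; 0] s k.
Proof.
move=> Kinf.
have /choice[pick pickP] : forall L, exists x, K x /\ x \notin L.
  move=> L; apply: contrapT => nL; apply: Kinf.
  apply: (@sub_finite_set _ _ [set` L]); last exact: finite_seq.
  move=> x Kx; apply: contrapT => xL; apply: nL; exists x; split=> //.
  exact/negP.
pose fix st k : seq V :=
  if k is k'.+1 then st k' ++ [seq x + pick (st k') | x <- st k']
  else [:: 0; 0].
have stE k : span_seq [:: 0; 0] (pick \o st) k = st k.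
  by elim: k => //= k ->.
exists (pick \o st); split=> k; first by have [] := pickP (st k).
by rewrite stE; have [] := pickP (st k).
Qed.

Lemma span_seq_adjoin s y k x : x \in span_seq [:: 0; y] s k ->
  x \in span_seq [:: 0; 0] s k \/ x + y \in span_seq [:: 0; 0] s k.
Proof.
elim: k x => [|k IH] x /=.
  rewrite !inE => /orP[]/eqP->; first by rewrite eqxx; left.
  by rewrite V2 eqxx; right.
rewrite !mem_cat => /orP[/IH[->|->]|/mapP[z /IH[zL|zL] ->]]; [by left|by right| |].
  by left; rewrite mem_shift ?orbT.
by right; rewrite addrAC mem_shift ?orbT.
Qed.

Lemma independent_adjoin s y :
  (forall k, s k \notin span_seq [:: 0; 0] s k) ->
  exists n, forall k, (n <= k)%N -> s k \notin span_seq [:: 0; y] s k.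
Proof.
move=> sI; have D0 k := @span_seq_closed _ s k (@pair_closed 0).
have [[n yn]|ny] := pselect (exists n, y \in span_seq [:: 0; 0] s n).
  exists n => k nk; apply/negP => /span_seq_adjoin.
  have yk := span_seq_le nk yn.
  move=> [sk|sk]; first by have /negP := sI k.
  by have := D0 _ _ _ sk yk; rewrite booladdK; exact/negP.
exists 0 => k _; apply/negP => /span_seq_adjoin[|sk]; first exact/negP.
by apply: ny; exists k.+1; rewrite /= mem_cat -(booladdKl (s k) y) addrC mem_shift ?orbT.
Qed.

(** An independent sequence can be chosen in [K].  Given such a sequence and [y], from
    some index on no term depends on [y] and its predecessors; a homomorphism that
    kills [y] and the terms before that index can thus be 1 on all later
    terms. *)
Lemma xor_morph_escape (K : set V) : infinite_set K ->
  exists s, (forall k, K (s k)) /\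
    forall y, exists h : V -> bool, xor_morph h /\
      exists n, forall k, (n <= k)%N -> h (s k) != h y.
Proof.
move=> /infinite_independent[s [Ks sI]]; exists s; split=> // y.
have [n nI] := independent_adjoin y sI.
pose L := span_seq [:: 0; y] s n.
have LD : add_closed L by apply: span_seq_closed; exact: pair_closed.
(* Killing the differences [s n + s k] makes [h] constant on the tail. *)
pose t j := s n + s (n + j.+1)%N.
have tS j : {subset span_seq L t j <= span_seq [:: 0; y] s (n + j.+1)}.
  elim: j => [|j IH] x; first exact: (span_seq_le (leq_addr _ n)).
  rewrite /= mem_cat addnS /= mem_cat => /orP[/IH->//|/mapP[z /IH zL ->]].
  apply/orP; right; rewrite /t addrA mem_shift//.
  have sn : s n \in span_seq [:: 0; y] s n.+1.
    rewrite /= mem_cat -[X in X \in map _ _]add0r mem_shift ?orbT//.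
    by rewrite (@span_seq_le _ _ 0)// inE eqxx.
  apply: span_seq_closed => //; first exact: pair_closed.
  by apply: (span_seq_le _ sn); rewrite addnS ltnS leq_addr.
have sU j : s n \notin span_seq L t j.
  elim: j => [|j IH] /=; first exact: nI.
  rewrite mem_cat (negbTE IH) /=; apply/negP => /mapP[z zL /eqP].
  rewrite /t addrCA -subr_eq0 opprD addrA subrr sub0r oppr_eq0 => /eqP zE.
  have zs : z = s (n + j.+1)%N by rewrite -(booladdK z (s (n + j.+1)%N)) zE add0r.
  have /negP := nI (n + j.+1)%N (leq_addr _ _); apply.
  by rewrite -zs; exact: tS.
have L0 : 0 \in L by rewrite (@span_seq_le _ _ 0)// inE eqxx.
have Ly : y \in L by rewrite (@span_seq_le _ _ 0)// !inE eqxx orbT.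
have [||/=|h [hD hU hs]] :=
  @xor_morph_separation [set u | exists j, u \in span_seq L t j] (s n).
- by exists 0.
- move=> a b /= [i ai] [j bj]; exists (maxn i j).
  by apply: span_seq_closed => //; [apply: (span_seq_le _ ai)|
    apply: (span_seq_le _ bj)]; rewrite ?leq_maxl ?leq_maxr.
- by move=> [j]; exact/negP.
exists h; split=> //; exists n => k nk.
rewrite (hU y); last by exists 0.
have [->|nk'] := eqVneq k n; first by rewrite hs.
have kE : k = (n + (k - n).-1.+1)%N.
  by rewrite prednK ?subnKC// subn_gt0 ltn_neqAle eq_sym nk' nk.
have : h (s n + s k) = false.
  have -> : s n + s k = t (k - n).-1 by rewrite /t -kE.
  apply: hU; exists (k - n).-1.+1; rewrite /= mem_cat; apply/orP; right.
  by rewrite -[X in X \in _]add0r mem_shift// (@span_seq_le _ _ 0).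
by rewrite hD hs /= => /negPn ->.
Qed.

(** Induction on the number of homomorphisms: if [h] is not already handled by the
    tail, some point is seen by [h] but by no member of the tail, and adding the
    head to [h] reduces to the tail. *)
Lemma xor_morph_span (I : eqType) (p : I -> V -> bool) (L : seq I) :
  (forall i, xor_morph (p i)) -> forall h : V -> bool, xor_morph h ->
  (forall x, (forall i, i \in L -> p i x = false) -> h x = false) ->
  exists F, subseq F L /\ forall x, h x = \big[addb/false]_(i <- F) p i x.
Proof.
move=> pD; elim: L => [|i L IH] h hD hL.
  by exists [::]; split=> // x; rewrite big_nil hL.
have [[v [vL hv]]|nv] :=
    pselect (exists v, (forall j, j \in L -> p j v = false) /\ h v).
  have iv : p i v.
    apply: contraPT hv => /negbTE iv; rewrite hL// => j.
    by rewrite inE => /orP[/eqP->//|]; exact: vL.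
  have [|x xL|F [FL FE]] := IH (fun x => h x (+) p i x).
  - by move=> x y; rewrite hD pD addbACA.
  - case ix: (p i x); last first.
      rewrite hL// => j; rewrite inE => /orP[/eqP->//|]; exact: xL.
    have : h (x + v) = false.
      apply: hL => j; rewrite pD inE => /orP[/eqP->|jL]; first by rewrite ix iv.
      by rewrite xL// vL.
    by rewrite hD hv; case: (h x).
  exists (i :: F); split=> [|x]; first by rewrite /= eqxx.
  by rewrite big_cons -FE addbC addbK.
have [//|x xL|F [FL FE]] := IH h.
  by apply/negbTE/negP => hx; apply: nv; exists x.
by exists F; split=> //; exact: subseq_trans FL (subseq_cons _ _).
Qed.

End BooleanGroup.

(** * Characters of Boolean groups *)

Section CircleOrderTwo.
Variable R : realType.
Implicit Types t u : circle R.

Lemma circle_order2 t : t + t = 0 -> t = 0 \/ circle_val t = -1.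
Proof.
move=> /(congr1 (@circle_val R)) /= t2.
have : circle_val t ^+ 2 == 1 by rewrite expr2; apply/eqP.
rewrite sqrf_eq1 => /orP[/eqP t1|/eqP t1]; last by right.
by left; apply: circle_val_inj.
Qed.

Lemma circle_order2_neq0 t u :
  t + t = 0 -> u + u = 0 -> (t + u != 0) = (t != 0) (+) (u != 0).
Proof.
move=> /circle_order2[->|tN1]; first by rewrite add0r eqxx.
move=> /circle_order2[->|uN1]; first by rewrite addr0 eqxx addbF.
have tu : t = u by apply: circle_val_inj; rewrite tN1.
rewrite -tu addbb; apply/negbTE/negPn/eqP/circle_val_inj.
by rewrite /= tN1 mulrNN mulr1.
Qed.

Lemma circle_order2_inj t u :
  t + t = 0 -> u + u = 0 -> (t != 0) = (u != 0) -> t = u.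
Proof.
move=> t2 u2 tu; have := circle_order2_neq0 t2 u2; rewrite tu addbb.
by move=> /negbFE/eqP /(congr1 (+%R^~ u)); rewrite -addrA u2 addr0 add0r.
Qed.

Definition circle_near : set (circle R * circle R) :=
  [set p | `|circle_val p.1 - circle_val p.2| < 1].

Lemma circle_near_entourage : entourage circle_near.
Proof. by apply/circle_entourageP; exists 1. Qed.

Lemma circle_near_order2 t u :
  t + t = 0 -> u + u = 0 -> circle_near (t, u) -> t = u.
Proof.
rewrite /circle_near /= => t2 u2.
have N2 : `|1 - -1 : R[i]| < 1 -> False.
  by rewrite opprK -mulr2n normr_nat -[X in _ < X]/(1%:R) ltr_nat.
have [->|tN1] := circle_order2 t2; have [->|uN1] := circle_order2 u2 => //=.
- by rewrite uN1 => /N2.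
- by rewrite tN1 distrC => /N2.
- by move=> _; apply: circle_val_inj; rewrite tN1.
Qed.

(** The square roots of 1 are isolated in the circle. *)
Lemma order2_valued_locally_constant (T : topologicalType)
    (f : T -> circle R) : (forall x, f x + f x = 0) -> continuous f ->
  forall x, \forall y \near x, f y = f x.
Proof.
move=> f2 fc x.
have /(_ circle_near circle_near_entourage) : forall E, entourage E ->
    \forall y \near x, E (f x, f y).
  by apply/(cvg_app_entourageP f); exact: fc.
by apply: filterS => y /circle_near_order2 ->.
Qed.

Definition minus_one : circle R := Circle (etrans (normrN _) (normr1 R[i])).

Definition circle_sign (b : bool) : circle R := if b then minus_one else 0.

Lemma circle_sign_neq0 b : (circle_sign b != 0) = b.
Proof.
case: b => /=; last by rewrite eqxx.
apply/eqP => /(congr1 (@circle_val R)) /= /eqP.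
by rewrite -subr_eq0 -opprD oppr_eq0 -mulr2n pnatr_eq0.
Qed.

Lemma circle_signD b c : circle_sign (b (+) c) = circle_sign b + circle_sign c.
Proof.
case: b; case: c => /=; rewrite ?addr0 ?add0r//.
by apply: circle_val_inj; rewrite /= mulrNN mulr1.
Qed.

End CircleOrderTwo.

Lemma cvg_initial (S : choiceType) (T : topologicalType) (f : S -> T)
    (F : set_system S) (s : S) : Filter F ->
  f @ F --> f s -> F --> (s : initial_topology f).
Proof.
move=> FF cf A [_ [[B oB <-] Bs BA]].
apply: filterS BA _; apply: cf.
by apply: open_nbhs_nbhs; split.
Qed.

Lemma dual_cvg (R : realType) (A : topologicalZmodType)
    (F : set_system (character R A)) (f : character R A) : Filter F ->
  (forall (K : set A) (E : set (circle R * circle R)),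
    compact K -> entourage E ->
    \forall h \near F, forall x, K x -> E (f x, (h : character R A) x)) ->
  F --> f.
Proof.
move=> FF FK; apply: cvg_initial.
apply/(compact_open_fam_compactP (@character_continuous R A f) _).
apply/(fam_cvgP (@compact A) _ _) => K cK B /uniform_nbhs[E [entE EB]].
by have := FK K E cK entE; apply: filterS => h hE; exact: EB.
Qed.

Section DualOfBoolean.
Variables (R : realType) (A : topologicalZmodType) (A2 : boolean_group A).
Implicit Types (a b : A) (f g : character R A).

Lemma character0 f : f 0 = 0.
Proof. by apply: (addrI (f 0)); rewrite addr0 -characterD addr0. Qed.

Lemma character_order2 f a : f a + f a = 0.
Proof. by rewrite -characterD A2 character0. Qed.

Lemma dual_boolean : boolean_group (character R A).
Proof.
by move=> f; apply: character_ext => a; rewrite character_addE character_order2.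
Qed.

Definition char_bit f a := f a != 0.

Lemma char_bitDr f : xor_morph (char_bit f).
Proof.
by move=> a b; rewrite /char_bit characterD circle_order2_neq0// character_order2.
Qed.

Lemma char_bitDl f g a : char_bit (f + g) a = char_bit f a (+) char_bit g a.
Proof.
by rewrite /char_bit character_addE circle_order2_neq0// character_order2.
Qed.

Lemma char_bit_inj f g a b : char_bit f a = char_bit g b -> f a = g b.
Proof. by apply: circle_order2_inj; exact: character_order2. Qed.

Lemma char_bit_near f a : \forall b \near a, char_bit f b = char_bit f a.
Proof.
have := order2_valued_locally_constant (character_order2 f)
  (@character_continuous _ _ f) a.
by apply: filterS => b; rewrite /char_bit => ->.
Qed.

Lemma char_eval_near f a :
  \forall g \near f, char_bit (g : character R A) a = char_bit f a.
Proof.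
have := order2_valued_locally_constant (fun g => character_order2 g a)
  (@character_continuous _ _ (evaluation R a)) f.
by apply: filterS => g; rewrite /char_bit /= => ->.
Qed.

End DualOfBoolean.

Lemma near_all_seq (T : Type) (F : set_system T) (I : eqType) (L : seq I)
    (P : I -> T -> Prop) : Filter F ->
  (forall i, i \in L -> \forall x \near F, P i x) ->
  \forall x \near F, forall i, i \in L -> P i x.
Proof.
move=> FF; elim: L => [|i L IH] PL; first exact: nearW.
have Pi := PL i (mem_head _ _).
have {}IH : \forall x \near F, forall j, j \in L -> P j x.
  by apply: IH => j jL; apply: PL; rewrite inE jL orbT.
near=> x => j; rewrite inE => /orP[/eqP->|jL]; first by near: x.
by have : forall j, j \in L -> P j x; [near: x|apply].
Unshelve. all: by end_near. Qed.

Section Reflexivity.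
Variables (R : realType) (A : topologicalZmodType) (A2 : boolean_group A).
Let D := character R A.
Hypothesis finA : forall K : set A, compact K -> finite_set K.
Hypothesis finD : forall K : set D, compact K -> finite_set K.
Hypothesis separated : forall a : A, (forall f : D, f a = 0) -> a = 0.
Hypothesis linearA : forall (a : A) (U : set A), nbhs a U ->
  exists L : seq D, forall b, (forall f, f \in L -> f b = f a) -> U b.

(** The compact-open topology only involves finite sets here, so the annihilators
    of finite subsets of [A] form a neighbourhood base at the trivial
    character. *)
Lemma bidual_finite_support (xi : character R D) :
  exists L : seq A, forall f : D, (forall a, a \in L -> f a = 0) -> xi f = 0.
Proof.
pose F : set_system D :=
  [set P | exists L : seq A, forall f : D, (forall a, a \in L -> f a = 0) -> P f].
have FF : Filter F.
  split.
  - by exists [::].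
  - move=> P Q [L LP] [M MQ]; exists (L ++ M) => f f0.
    by split; [apply: LP|apply: MQ] => a aL; apply: f0; rewrite mem_cat aL ?orbT.
  - by move=> P Q PQ [L LP]; exists L => f /LP /PQ.
have F0 : F --> (0 : D).
  apply: dual_cvg => K E cK entE.
  have /finite_seqP[L KL] := finA cK.
  exists L => f f0 a Ka; rewrite f0; first exact: entourage_refl.
  by move: Ka; rewrite KL.
have near0 := order2_valued_locally_constant
  (character_order2 (dual_boolean A2) xi) (@character_continuous _ _ xi) 0.
have [L LP] : F [set f | xi f = xi 0] := F0 _ near0.
by exists L => f /LP /= ->; rewrite character0.
Qed.

Lemma evaluation_surjective (xi : character R D) :
  exists a, evaluation R a = xi.
Proof.
have [L L0] := bidual_finite_support xi.
have D2 := dual_boolean A2 : boolean_group D.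
have [||f fL|F [_ FE]] := @xor_morph_span D A (fun a f => char_bit f a) L _
  (char_bit xi).
- by move=> a f g; exact: char_bitDl.
- exact: char_bitDr.
- apply/negbTE/negPn/eqP/L0 => a /fL /negbFE/eqP; exact.
exists (\sum_(a <- F) a); apply: character_ext => f; apply: (char_bit_inj D2).
rewrite FE; apply: (big_morph (char_bit f) (char_bitDr A2 f)).
exact: (xor_morph0 A2 (char_bitDr A2 f)).
Qed.

Lemma evaluation_injective : injective (@evaluation R A).
Proof.
move=> a b /(congr1 (fun xi : character R D => (xi : D -> _))) /= ab.
apply/subr0_eq; apply: separated => f.
have /(congr1 (+%R^~ (f b))) : f a = f b := congr1 (fun h => h f) ab.
have -> : - b = b by apply/esym/eqP; rewrite -addr_eq0 A2.
by rewrite character_order2// -characterD.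
Qed.

(** Surjectivity comes from the finiteness of the compact sets of [A], continuity
    of the evaluation from that of the compact sets of the dual. *)
Theorem boolean_reflexive : reflexive_group R A.
Proof.
have D2 := dual_boolean A2 : boolean_group D.
have [ev_inv evK] := choice evaluation_surjective.
split; first by move=> a b; apply: character_ext => f; rewrite character_addE /= characterD.
split.
  move=> a; apply: dual_cvg => K E cK entE.
  have /finite_seqP[L KL] := finD cK; rewrite KL /=.
  apply: (@near_all_seq _ _ D L (fun f b => E (f a, f b))) => f _.
  have := order2_valued_locally_constant (character_order2 A2 f)
    (@character_continuous _ _ f) a.
  by apply: filterS => b ->; exact: entourage_refl.
exists ev_inv; split=> //.
  by move=> a; apply: evaluation_injective; rewrite evK.
move=> xi U /linearA[L LU].
have : \forall xi' \near xi, forall f, f \in L ->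
    char_bit (xi' : character R D) f = char_bit xi f.
  apply: (@near_all_seq _ _ D L
    (fun f (xi' : character R D) => char_bit xi' f = char_bit xi f)
    (nbhs_filter xi)) => f _.
  exact: char_eval_near.
apply: filterS => xi' xiE; apply: LU => f /xiE.
by rewrite -{1}(evK xi) -{1}(evK xi') => /(char_bit_inj D2).
Qed.

End Reflexivity.

(** * Topological subgroups of a Cantor cube *)

(** A cluster point [y] of the sequence would contradict the local constancy at [y]
    of the function that tells [y] apart from almost all terms. *)
Lemma compact_escape (T : topologicalType) (K : set T) (F : set (T -> bool)) :
  (forall f, F f -> forall x, \forall y \near x, f y = f x) ->
  (infinite_set K -> exists s : nat -> T, (forall k, K (s k)) /\
    forall y, exists f, F f /\
      exists n, forall k, (n <= k)%N -> f (s k) != f y) ->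
  compact K -> finite_set K.
Proof.
move=> Fnear Kesc cK; apply: contrapT => /Kesc[s [Ks sE]].
have sK : (s @ \oo) K by exists 0%N => // k _; exact: Ks.
have [y [_ yc]] := cK (s @ \oo) _ sK.
have [f [Ff [n fn]]] := sE y.
have : (s @ \oo) [set z | f z != f y] by exists n.
move=> /yc /(_ (Fnear f Ff y))[z [/=]] /[swap] -> /eqP.
by [].
Qed.

Definition cube (X : eqType) : Type := X -> bool.

Section Cube.
Variable X : eqType.
Implicit Types (z w : cube X).

HB.instance Definition _ := Topological.copy (cube X) {ptws X -> bool}.
HB.instance Definition _ := GRing.Zmodule.copy (cube X) (X -> bool).

Lemma cube_boolean : boolean_group (cube X).
Proof. by move=> z; apply: funext => x; exact: addbb. Qed.

Lemma cube_near z x : \forall w \near z, w x = z x.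
Proof.
have FF : Filter (nbhs z) := nbhs_filter z.
have /cvg_sup/(_ x) zz : nbhs z --> (z : {ptws X -> bool}) by exact: cvg_id.
pose ev := fun w : cube X => w x.
have : nbhs (z : initial_topology ev) [set w | w x = z x].
  exact: (@initial_continuous (cube X) bool ev z [set b | b = z x]).
exact: zz.
Qed.

Lemma cube_cvg (F : set_system (cube X)) z : Filter F ->
  (forall x, \forall w \near F, w x = z x) -> F --> z.
Proof.
move=> FF Fz; apply/cvg_sup => x.
apply: (@cvg_initial (cube X) bool (fun w => w x)) => U Uz.
by have := Fz x; apply: filterS => w /= ->; exact: nbhs_singleton.
Qed.

Lemma cube_nbhs z (U : set (cube X)) : nbhs z U ->
  exists L : seq X, forall w, (forall x, x \in L -> w x = z x) -> U w.
Proof.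
pose F : set_system (cube X) := [set P | exists L : seq X,
  forall w, (forall x, x \in L -> w x = z x) -> P w].
have FF : Filter F.
  split.
  - by exists [::].
  - move=> P Q [L LP] [M MQ]; exists (L ++ M) => w wz.
    by split; [apply: LP|apply: MQ] => x xL; apply: wz; rewrite mem_cat xL ?orbT.
  - by move=> P Q PQ [L LP]; exists L => w /LP /PQ.
have Fz : F --> z.
  by apply: cube_cvg => x; exists [:: x] => w; apply; rewrite inE.
exact: Fz.
Qed.

Lemma cube_compact : compact [set: cube X].
Proof.
have := @tychonoff X (fun _ => bool) (fun _ => setT)
  (fun _ => bool_compact).
by congr compact; apply/seteqP; split.
Qed.

Lemma cube_hausdorff : hausdorff_space (cube X).
Proof.
move=> z w zw; apply: funext => x.
by have [u [/= -> ->]] := zw _ _ (cube_near z x) (cube_near w x).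
Qed.

HB.instance Definition _ := isGroup.Build (cube X)
  (@addrA (cube X)) (@add0r (cube X)) (@addr0 (cube X))
  (@addNr (cube X)) (@addrN (cube X)).

Lemma cube_mul_continuous :
  continuous (fun p : cube X * cube X => (p.1 * p.2)%g).
Proof.
move=> [z w]; apply: cube_cvg => x.
exists ([set u | u x = z x], [set u | u x = w x]).
  by split; exact: cube_near.
by move=> [z' w'] [/= z'E w'E]; exact: (congr2 addb z'E w'E).
Qed.

Lemma cube_inv_continuous : continuous (fun z : cube X => (z^-1)%g).
Proof.
by move=> z; apply: cube_cvg => x; exact: cube_near.
Qed.

HB.instance Definition _ :=
  isTopologicalGroup.Build (cube X) cube_mul_continuous cube_inv_continuous.

End Cube.

Definition pattern_dense (X : eqType) (H : set (cube X)) :=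
  forall (L : seq X) (z : cube X), exists2 w, H w & forall x, x \in L -> w x = z x.

Section CubeSubgroup.
Variables (X : eqType) (H : set (cube X)).
Variables (H0 : H 0) (HD : forall z w, H z -> H w -> H (z + w)).

(** The closure properties are parameters of the type because its group structure
    is built from them. *)
Definition cube_subgroup of H 0 & (forall z w, H z -> H w -> H (z + w)) : Type :=
  set_type H.
Local Notation G := (cube_subgroup H0 HD).
Implicit Types (z w : G).

HB.instance Definition _ := Topological.copy G (set_type H).

Definition subcube_val z : cube X := set_val z.
Local Notation v := subcube_val.

Definition subcube (z : cube X) (Hz : H z) : G := exist _ z (mem_set Hz).

Lemma subcube_valP z : H (v z).
Proof. exact: set_valP. Qed.

Lemma subcube_val_inj : injective v.
Proof. exact: val_inj. Qed.

Let addG z w := subcube (HD (subcube_valP z) (subcube_valP w)).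
Let addA : associative addG.
Proof. by move=> z w u; apply: subcube_val_inj; exact: addrA. Qed.
Let addC : commutative addG.
Proof. by move=> z w; apply: subcube_val_inj; exact: addrC. Qed.
Let add0 : left_id (subcube H0) addG.
Proof. by move=> z; apply: subcube_val_inj; exact: add0r. Qed.
Let addN : left_inverse (subcube H0) id addG.
Proof. by move=> z; apply: subcube_val_inj; exact: cube_boolean. Qed.

HB.instance Definition _ := GRing.isZmodule.Build G addA addC add0 addN.

Lemma subcube_near z x : \forall w \near z, v w x = v z x.
Proof. exact: (@initial_continuous G (cube X) v z _ (cube_near (v z) x)). Qed.

Lemma subcube_cvg (F : set_system G) z : Filter F ->
  (forall x, \forall w \near F, v w x = v z x) -> F --> z.
Proof.
move=> FF Fz; apply: (@cvg_initial G (cube X) v).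
exact: cube_cvg.
Qed.

Lemma subcube_nbhs z U : nbhs z U ->
  exists L : seq X, forall w, (forall x, x \in L -> v w x = v z x) -> U w.
Proof.
move=> [_ [[B oB <-] Bz BU]].
have [|L LB] := @cube_nbhs X (v z) B; first exact: open_nbhs_nbhs.
by exists L => w /LB /BU.
Qed.

Let sub_continuous : continuous (fun p : G * G => p.1 - p.2).
Proof.
move=> [z w]; apply: subcube_cvg => x.
exists ([set u | v u x = v z x], [set u | v u x = v w x]).
  by split; exact: subcube_near.
by move=> [z' w'] [/= z'E w'E]; exact: (congr2 addb z'E w'E).
Qed.

HB.instance Definition _ :=
  PreTopologicalNmodule_isTopologicalZmodule.Build G sub_continuous.

Lemma subcube_boolean : boolean_group G.
Proof. by move=> z; apply: subcube_val_inj; exact: cube_boolean. Qed.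

Hypothesis Hdense : pattern_dense H.

Lemma subcube_precompact : precompact_group G.
Proof.
exists (cube X), H, (fun z : G => z : set_type H); split.
- by split; [exact: cube_compact|exact: cube_hausdorff].
- split.
    split; first exact/mem_set.
    by move=> z w /set_mem Hz /set_mem Hw; apply/mem_set; exact: HD.
  move=> O [z Oz] oO.
  have [|L LO] := @cube_nbhs X z O; first exact: open_nbhs_nbhs.
  have [w Hw wz] := Hdense L z.
  by exists w; split=> //; exact: LO.
- by [].
- split; first by move=> z; exact: cvg_id.
  by exists (fun z : set_type H => z : G); split=> // z; exact: cvg_id.
Qed.

Variable R : realType.

Let coord_morph x : {morph (fun z => circle_sign R (v z x)) : z w / z + w}.
Proof. by move=> z w; rewrite -circle_signD. Qed.

Let coord_continuous x : continuous (fun z => circle_sign R (v z x)).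
Proof.
move=> z U Uz; have := subcube_near z x; apply: filterS => w /= ->.
exact: nbhs_singleton.
Qed.

Definition coordinate x : character R G :=
  Character (@coord_morph x) (@coord_continuous x).

Lemma coordinate_bit x z : char_bit (coordinate x) z = v z x.
Proof. exact: circle_sign_neq0. Qed.

Lemma subcube_separated z : (forall f : character R G, f z = 0) -> z = 0.
Proof.
move=> z0; apply: subcube_val_inj; apply: funext => x.
by rewrite -coordinate_bit /char_bit z0 eqxx.
Qed.

Lemma subcube_linear_nbhs z (U : set G) : nbhs z U ->
  exists L : seq (character R G),
    forall w, (forall f, f \in L -> f w = f z) -> U w.
Proof.
move=> /subcube_nbhs[L LU]; exists [seq coordinate x | x <- L] => w wz.
apply: LU => x xL; rewrite -!coordinate_bit /char_bit wz//.
exact: map_f.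
Qed.

(** A character is trivial near 0, hence wherever certain finitely many coordinates
    vanish; so it is a sum of some of these coordinates. *)
Lemma subcube_character (f : character R G) :
  exists2 F : seq X, uniq F &
    forall z, char_bit f z = \big[addb/false]_(x <- F) v z x.
Proof.
have /subcube_nbhs[L L0] := char_bit_near subcube_boolean f 0.
have [||z zL|F [FL FE]] := @xor_morph_span G X (fun x z => v z x) (undup L) _
  (char_bit f).
- by [].
- exact: (char_bitDr subcube_boolean f).
- rewrite L0; last by move=> x xL; rewrite zL// mem_undup.
  by rewrite /char_bit character0 eqxx.
by exists F => //; exact: subseq_uniq FL (undup_uniq L).
Qed.

(** The coordinates alone serve as the separating functions. *)
Lemma subcube_compact_finite :
  (forall K : set (cube X), infinite_set K -> K `<=` H ->
    exists s : nat -> cube X, (forall k, K (s k)) /\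
      forall z : cube X, H z -> exists x, exists n, forall k, (n <= k)%N ->
        s k x != z x) ->
  forall K : set G, compact K -> finite_set K.
Proof.
move=> Hesc K; apply: (@compact_escape G K
  [set g | exists x, g = fun z => v z x]).
  by move=> _ [x ->] z; exact: subcube_near.
move=> Kinf.
have vKinf : infinite_set (v @` K).
  apply: contra_not Kinf => vKfin.
  apply: (@sub_finite_set _ _ (v @^-1` (v @` K))); first by move=> z Kz; exists z.
  by apply: finite_preimage => // z w _ _ /subcube_val_inj.
have [|s [sK sE]] := Hesc _ vKinf.
  by move=> _ [z _ <-]; exact: subcube_valP.
have /choice[t tE] : forall k, exists z, K z /\ v z = s k.
  by move=> k; have [z] := sK k; exists z.
exists t; split=> [k|z]; first by have [] := tE k.
have [x [n xn]] := sE _ (subcube_valP z).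
exists (fun z => v z x); split; first by exists x.
by exists n => k /xn; have [_ ->] := tE k.
Qed.

Definition xor_sum (F : seq X) (z : cube X) := \big[addb/false]_(x <- F) z x.

(** Characters are represented by duplicate-free lists of coordinates, and the
    separating functions are the evaluations at points of the subgroup. *)
Lemma subcube_dual_compact_finite :
  (forall S : set (seq X), infinite_set S -> (forall F, S F -> uniq F) ->
    (forall F F', S F -> S F' -> F =i F' -> F = F') ->
    exists s : nat -> seq X, (forall k, S (s k)) /\
      forall F, uniq F -> exists2 z : cube X, H z & exists n, forall k, (n <= k)%N ->
        xor_sum (s k) z != xor_sum F z) ->
  forall K : set (character R G), compact K -> finite_set K.
Proof.
move=> Hesc K; apply: (@compact_escape (character R G) K
  [set h | exists z : G, h = fun f : character R G => char_bit f z]).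
  by move=> _ [z ->] f; exact: (char_eval_near subcube_boolean).
have /choice[F FP] : forall f : character R G, exists F, uniq F /\
    forall z, char_bit f z = xor_sum F (v z).
  by move=> f; have [F uF FE] := subcube_character f; exists F.
have Finj f g : F f =i F g -> f = g.
  move=> fg; apply: character_ext => z; apply: (char_bit_inj subcube_boolean).
  rewrite !(FP _).2; apply: perm_big; apply: uniq_perm => //; first exact: (FP _).1.
  exact: (FP _).1.
move=> Kinf.
have [|_ [f _ <-]|_ _ [f _ <-] [g _ <-] /Finj ->//|s [sK sE]] := Hesc (F @` K).
- apply: contra_not Kinf => FKfin.
  apply: (@sub_finite_set _ _ (F @^-1` (F @` K))); first by move=> f Kf; exists f.
  by apply: finite_preimage => // f g _ _ fg; apply: Finj => x; rewrite fg.
- exact: (FP f).1.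
have /choice[t tE] : forall k, exists f, K f /\ F f = s k.
  by move=> k; have [f] := sK k; exists f.
exists t; split=> [k|f]; first by have [] := tE k.
have [z Hz [n zn]] := sE _ (FP f).1.
exists (fun g : character R G => char_bit g (subcube Hz)).
split; first by exists (subcube Hz).
by exists n => k /zn; have [_ <-] := tE k; rewrite !(FP _).2.
Qed.

(** A basic open set restricts only a finite set [L] of coordinates.  By density it
    has a member that follows [w] on [M] outside [L], and a whole neighbourhood of
    that member misses [B c]. *)
Lemma subcube_first_category (B : nat -> set (cube X)) :
  (forall z : cube X, H z -> exists c, B c z) ->
  (forall c (L : seq X), exists (M : seq X), exists w : cube X,
     forall z : cube X, (forall x, x \in M -> x \notin L -> z x = w x) -> ~ B c z) ->
  first_category G.
Proof.
move=> HB Bnd; exists (fun c => [set z : G | B c (v z)]); split; last first.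
  apply/seteqP; split=> // z _.
  by have [c Bz] := HB _ (subcube_valP z); exists c.
move=> c; apply/seteqP; split=> // z /subcube_nbhs[L zL].
have [M [w wB]] := Bnd c L.
have [u Hu uE] := Hdense (L ++ M) (fun x => if x \in L then v z x else w x).
have /zL : forall x, x \in L -> v (subcube Hu) x = v z x.
  by move=> x xL; rewrite -[LHS]/(u x) uE ?mem_cat xL.
have near_u : \forall t \near subcube Hu, forall x, x \in M -> v t x = u x.
  apply: (near_all_seq (nbhs_filter (subcube Hu))) => x _.
  exact: (subcube_near (subcube Hu) x).
move=> /(_ _ near_u)[t [Bt tu]].
apply: (wB (v t)) => // x xM xL; rewrite tu// uE; last by rewrite mem_cat xM orbT.
by rewrite (negbTE xL).
Qed.

End CubeSubgroup.

(** * The twisted subgroup *)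

(** A node carries a sequence of children, the values that it prescribes at them, and
    a functional on sequences; the leaves index the coordinates of a sequence. *)
Inductive tree : Type :=
| leaf of nat
| node of (nat -> tree) & (nat -> bool) & {mu : (nat -> bool) -> bool | xor_morph mu}.

HB.instance Definition _ := gen_eqMixin tree.

Definition child (y x : tree) : Prop :=
  if x is node c _ _ then exists k, c k = y else False.

Lemma child_asym x y : child y x -> ~ child x y.
Proof.
elim: x y => //= c IH f mu y [k <-] xk.
by apply: (IH k (node c f mu)) => //; exists k.
Qed.

(** A child may be listed several times; one of its positions is selected. *)
Definition label (x y : tree) : bool :=
  if x is node c f _ then
    if pselect (exists k, c k = y) is left cy then f (projT1 (cid cy)) else false
  else false.

Lemma label_node c (h : tree -> bool) mu k :
  label (node c (h \o c) mu) (c k) = h (c k).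
Proof.
rewrite /label; case: pselect => [cy|[]]; last by exists k.
exact: (congr1 h (projT2 (cid cy))).
Qed.

Definition is_node (x : tree) := if x is node _ _ _ then true else false.

(** The pairing of a generator [y] with the coordinate [x].  If one is a child of the
    other, the parent prescribes the value, so that the pairing can be prescribed
    from either side.  The leaf coordinates ignore the generators. *)
Definition incidence (y x : tree) : bool :=
  is_node x && (if `[< child y x >] then label x y else label y x).

Lemma incidence_child c h mu k :
  incidence (c k) (node c (h \o c) mu) = h (c k).
Proof.
rewrite /incidence asboolT; last by exists k.
exact: label_node.
Qed.

Lemma incidence_parent c h mu k :
  is_node (c k) -> incidence (node c (h \o c) mu) (c k) = h (c k).
Proof.
rewrite /incidence => ->; rewrite asboolF; first exact: label_node.
by apply: child_asym; exists k.
Qed.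

(** The sequence [m] is seen at the leaves directly and at the nodes through their
    functionals. *)
Definition base_part (m : nat -> bool) : cube tree :=
  fun x => match x with leaf k => m k | node _ _ mu => sval mu m end.

Lemma base_partD m n : base_part (m + n) = base_part m + base_part n.
Proof. by apply: funext => -[k|c f mu] //=; exact: (svalP mu). Qed.

Definition free_part (l : seq tree) : cube tree := \sum_(y <- l) incidence y.

Definition sparse_bound (c : nat) (m : nat -> bool) :=
  forall n, (count m (iota 0 (2 ^ n)) <= c * n.+1)%N.

(** The sum of a copy of the sparse sequences and of the group freely generated by
    [tree].  The latter is killed by the leaf coordinates, so the leaves detect the
    sparse sequence. *)
Definition twisted (z : cube tree) := exists (m : nat -> bool) (l : seq tree),
  (exists c, sparse_bound c m) /\ z = base_part m + free_part l.

Lemma sparse_boundD c d m n :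
  sparse_bound c m -> sparse_bound d n -> sparse_bound (c + d) (m + n).
Proof.
move=> mc nd k; rewrite mulnDl (leq_trans _ (leq_add (mc k) (nd k)))//.
rewrite -count_predUI (leq_trans _ (leq_addr _ _))// sub_count// => i.
by rewrite /= [(m + n) i]/(m i (+) n i); case: (m i).
Qed.

Lemma twisted0 : twisted 0.
Proof.
exists 0, [::]; split.
  by exists 0 => n; rewrite (@eq_count _ _ pred0) ?count_pred0.
rewrite /free_part big_nil addr0; apply/esym/(addrI (base_part 0)).
by rewrite -base_partD !addr0.
Qed.

Lemma twistedD z w : twisted z -> twisted w -> twisted (z + w).
Proof.
move=> [m [l [[c mc] ->]]] [n [k [[d nd] ->]]]; exists (m + n), (l ++ k).
split; first by exists (c + d)%N; exact: sparse_boundD.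
by rewrite base_partD /free_part big_cat /= addrACA.
Qed.

Lemma twisted_leaf m l k : (base_part m + free_part l) (leaf k) = m k.
Proof.
rewrite -[LHS]/(m k + free_part l (leaf k)) /free_part fct_sumE big1 ?addr0//.
Qed.

Lemma countable_cover (l : nat -> seq tree) :
  exists c : nat -> tree, forall k x, x \in l k -> exists i, c i = x.
Proof.
exists (fun i => if unpickle i is Some (k, j) then nth (leaf 0) (l k) j else leaf 0).
by move=> k x xl; exists (pickle (k, index x (l k))); rewrite pickleK nth_index.
Qed.

Lemma xor_morph_false : xor_morph (fun _ : nat -> bool => false).
Proof. by []. Qed.

Definition zero_functional := exist _ _ xor_morph_false.

Lemma count_leaf_le (L : seq tree) n :
  (count (fun k => leaf k \in L) (iota 0 n) <= size L)%N.
Proof.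
rewrite -size_filter -(size_map leaf); apply: uniq_leq_size.
  rewrite map_inj_uniq; last by move=> i j [].
  exact/filter_uniq/iota_uniq.
by move=> _ /mapP[k + ->]; rewrite mem_filter => /andP[].
Qed.

Lemma finite_sparse (L : seq tree) (m : nat -> bool) :
  (forall k, m k -> leaf k \in L) -> sparse_bound (size L) m.
Proof.
move=> mL n; apply: (@leq_trans (size L)); last by rewrite leq_pmulr.
by apply: leq_trans (count_leaf_le L (2 ^ n)); apply: sub_count.
Qed.

(** The leaves are matched by a finitely supported sequence, and the nodes are then
    corrected by one generator, which has all of them among its children. *)
Lemma twisted_dense : pattern_dense twisted.
Proof.
move=> L z; have [c cL] := countable_cover (fun _ => L).
pose m k := (leaf k \in L) && z (leaf k).
pose h x := z x (+) base_part m x.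
exists (base_part m + free_part [:: node c (h \o c) zero_functional]).
  exists m, [:: node c (h \o c) zero_functional]; split=> //.
  by exists (size L); apply: finite_sparse => k /andP[].
case=> [k|c' f mu] xL; first by rewrite twisted_leaf /m xL.
have [i ci] := cL 0 _ xL.
rewrite /free_part big_seq1 -ci -[LHS]/(base_part m (c i) (+) incidence _ (c i)).
by rewrite incidence_parent ?ci// /h addbC addbK.
Qed.

(** A node can prescribe the restriction of [h] to the sparse sequences by its
    functional, and the values of [h] at the countably many generators involved by
    its labels. *)
Lemma twisted_countable_coordinate (h : cube tree -> bool) (s : nat -> cube tree) :
  xor_morph h -> (forall k, twisted (s k)) ->
  exists x, forall k, s k x = h (s k).
Proof.
move=> hD /choice[m] /choice[l sE].
have [c cl] := countable_cover l.
have muD : xor_morph (h \o base_part) by move=> i j; rewrite /= base_partD hD.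
pose x := node c ((h \o incidence) \o c) (exist _ _ muD).
exists x => k; have [_ ->] := sE k.
rewrite hD -[LHS]/(h (base_part (m k)) (+) free_part (l k) x); congr addb.
rewrite /free_part (big_morph h hD (xor_morph0 (@cube_boolean tree) hD)).
rewrite fct_sumE.
rewrite [RHS]big_seq_cond [LHS]big_seq_cond; apply: eq_bigr => y /andP[/cl[i <-] _].
exact: incidence_child.
Qed.

Lemma twisted_escape (K : set (cube tree)) : infinite_set K -> K `<=` twisted ->
  exists s : nat -> cube tree, (forall k, K (s k)) /\
    forall z, twisted z -> exists x, exists n, forall k, (n <= k)%N ->
      s k x != z x.
Proof.
move=> Kinf KT.
have [s [sK sE]] := xor_morph_escape (@cube_boolean tree) Kinf.
exists s; split=> // z Tz; have [h [hD [n hn]]] := sE z.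
have [|x xE] := @twisted_countable_coordinate h
  (fun k => if k is k'.+1 then s k' else z) hD.
  by case=> // k; exact: KT.
exists x, n => k /hn.
by rewrite -(xE k.+1) -(xE 0).
Qed.

Definition node_part (F : seq tree) : cube tree := fun x => is_node x && (x \in F).

Definition point_mass (x : tree) : cube tree := fun y => y == x.

Lemma node_part_sum F : uniq F ->
  node_part F = \sum_(x <- F | is_node x) point_mass x.
Proof.
elim: F => [_|x F IH /= /andP[xF uF]].
  by rewrite big_nil; apply: funext => y; rewrite /node_part andbF.
rewrite big_cons -IH//; apply: funext => y; rewrite /node_part inE.
have [->|yx] := eqVneq y x; case: ifPn => nx.
- by rewrite -[RHS]/((x == x) (+) (is_node x && (x \in F))) eqxx (negbTE xF) nx.
- by rewrite (negbTE nx).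
- by rewrite -[RHS]/((y == x) (+) (is_node y && (y \in F))) (negbTE yx).
- by [].
Qed.

(** The dual counterpart of [twisted_countable_coordinate]: one generator realizes
    [h] on the node parts of countably many characters. *)
Lemma twisted_realize (h : cube tree -> bool) (s : nat -> seq tree) :
  xor_morph h -> (forall k, uniq (s k)) ->
  exists2 z, twisted z & forall k, xor_sum (s k) z = h (node_part (s k)).
Proof.
move=> hD su; have [c cs] := countable_cover s.
pose y := node c ((h \o point_mass) \o c) zero_functional.
exists (incidence y).
  exists 0, [:: y]; split; first by exists 0 => n; rewrite (@eq_count _ _ pred0) ?count_pred0.
  rewrite /free_part big_seq1; apply/esym/(addrI (base_part 0)).
  by rewrite addrA -base_partD addr0.
move=> k; rewrite node_part_sum//.
rewrite (big_morph h hD (xor_morph0 (@cube_boolean tree) hD)) /xor_sum.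
rewrite (bigID is_node) /= [X in _ (+) X]big1 ?addbF; last first.
  by move=> x /negbTE nx; rewrite /incidence nx.
rewrite [RHS]big_seq_cond [LHS]big_seq_cond.
apply: eq_bigr => x /andP[/cs[i <-]]; exact: incidence_parent.
Qed.

(** * Infinite families of characters *)

(** The functional [lam k] depends on the arguments below [b k] only, and toggling
    the sequence at [p k] toggles its value.  As [p k.+1] is not below [b k], the
    equations can be solved one after the other without disturbing those already
    solved.  They are imposed from [n] on, which leaves the sequence zero below
    [p n]. *)
Lemma triangular_solution (p b : nat -> nat) (lam : nat -> (nat -> bool) -> bool) :
  (forall k, xor_morph (lam k)) ->
  (forall k m m', (forall i, (i < b k)%N -> m i = m' i) -> lam k m = lam k m') ->
  (forall k, lam k (fun i => i == p k)) ->
  (forall k, (p k < b k)%N) -> (forall k, (b k <= p k.+1)%N) ->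
  forall n, exists m : nat -> bool,
    (forall i, m i -> exists2 k, (n <= k)%N & i = p k) /\
    (forall k, (n <= k)%N -> lam k m).
Proof.
move=> lamD lamb lamp pb bp n.
have p_lt k : (p k < p k.+1)%N by apply: leq_trans (bp k).
have p_mono : {homo p : i j / (i <= j)%N}.
  by apply: homo_leq => //; [exact: leq_trans|move=> k; exact: ltnW].
have p_ge k : (k <= p k)%N by elim: k => // k IH; exact: leq_ltn_trans (p_lt k).
pose fix approx k : nat -> bool :=
  if k is k'.+1 then
    if (n <= k')%N && ~~ lam k' (approx k') then
      fun i => approx k' i (+) (i == p k')
    else approx k'
  else fun _ => false.
have approx_le k l i : (k <= l)%N -> (i < p k)%N -> approx l i = approx k i.
  move=> /subnK <- ik; elim: (l - k)%N => //= d IH; case: ifP => _ //.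
  rewrite IH; case: eqP => [ip|]; last by rewrite addbF.
  by move: ik; rewrite ip ltnNge p_mono// leq_addl.
have lamS k : (n <= k)%N -> lam k (approx k.+1).
  move=> nk /=; rewrite nk /=; case: ifP => [/negbTE lk|/negbFE//].
  have -> : (fun i => approx k i (+) (i == p k)) = approx k + (fun i => i == p k).
    by [].
  by rewrite lamD lk lamp.
(* The approximations do not change at [i] from stage [i.+1] on. *)
exists (fun i => approx i.+1 i); split.
  move=> i; elim: {1}i.+1 => //= k IH; case: ifP => [/andP[nk _]|_ //].
  case: eqP => [-> _|_]; first by exists k.
  by rewrite addbF.
move=> k nk; rewrite -(lamb k (approx k.+1)); first exact: lamS.
move=> i ib; have [ki|ik] := leqP k.+1 i.+1.
  by rewrite (approx_le k.+1 i.+1)// (leq_trans ib).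
by rewrite (approx_le i.+1 k.+1)// ?(ltnW ik)// (leq_trans (p_ge i.+1)).
Qed.

Lemma sparse_support (p : nat -> nat) (m : nat -> bool) :
  (forall k, (2 ^ k <= p k)%N) -> (forall i, m i -> exists k, i = p k) ->
  sparse_bound 1 m.
Proof.
move=> p_ge mp n; rewrite mul1n -size_filter.
apply: (@leq_trans (size [seq p k | k <- iota 0 n])).
  apply: uniq_leq_size; first exact/filter_uniq/iota_uniq.
  move=> i; rewrite mem_filter mem_iota add0n => /andP[/mp[k ->] pk].
  apply: map_f; rewrite mem_iota add0n leq0n /=.
  by rewrite -(ltn_exp2l k n (isT : 1 < 2)%N); exact: leq_ltn_trans pk.
by rewrite size_map size_iota.
Qed.

Lemma leaf_bound (F : seq tree) : exists b, forall k, leaf k \in F -> (k < b)%N.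
Proof.
elim: F => [|[i|c f mu] F [b bF]]; first by exists 0.
  exists (maxn i.+1 b) => k; rewrite inE => /orP[/eqP[->]|/bF kb].
    by rewrite leq_maxl.
  by rewrite (leq_trans kb)// leq_maxr.
by exists b => k; rewrite inE => /orP[/eqP//|/bF].
Qed.

Definition leaf_sum (F : seq tree) (m : nat -> bool) : bool :=
  \big[addb/false]_(x <- F) (if x is leaf k then m k else false).

Lemma leaf_sumD F : xor_morph (leaf_sum F).
Proof.
move=> m n; rewrite /leaf_sum -big_split /=.
by apply: eq_bigr => -[k|c f mu] _.
Qed.

Lemma leaf_sum_eq F m n :
  (forall k, leaf k \in F -> m k = n k) -> leaf_sum F m = leaf_sum F n.
Proof.
move=> mn; rewrite /leaf_sum big_seq_cond [RHS]big_seq_cond.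
by apply: eq_bigr => -[k|c f mu] /andP[xF _] //; exact: mn.
Qed.

Lemma leaf_sum_mass F p : uniq F -> leaf p \in F ->
  leaf_sum F (fun i => i == p).
Proof.
move=> uF pF; rewrite /leaf_sum (bigD1_seq (leaf p))//= eqxx big1 ?addbF// => -[k|//] kp.
by apply: contraNF kp => /eqP ->.
Qed.

Lemma xor_sum_leaf F m :
  xor_sum F (base_part m) = leaf_sum F m (+)
    \big[addb/false]_(x <- F | is_node x) base_part m x.
Proof.
rewrite /xor_sum (bigID is_node) /= addbC; congr addb.
rewrite /leaf_sum [RHS](bigID is_node) /= [X in _ = X (+) _]big1; last by case.
by rewrite addFb; apply: eq_bigr => -[].
Qed.

Lemma node_part_sum_eq E F (z : cube tree) : uniq E -> uniq F ->
  node_part E = node_part F ->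
  \big[addb/false]_(x <- E | is_node x) z x =
  \big[addb/false]_(x <- F | is_node x) z x.
Proof.
move=> uE uF EF; rewrite -big_filter -[RHS]big_filter; apply: perm_big.
apply: uniq_perm; rewrite ?filter_uniq// => x; rewrite !mem_filter.
by have := congr1 (fun u : cube tree => u x) EF.
Qed.

(** These finite sets differ in their leaves only, and finitely many leaves allow
    only finitely many of them. *)
Lemma unbounded_leaves (S : set (seq tree)) (v : cube tree) :
  infinite_set S -> (forall F, S F -> node_part F = v) ->
  (forall E F, S E -> S F -> E =i F -> E = F) ->
  forall b, exists F k, [/\ S F, leaf k \in F & (b <= k)%N].
Proof.
move=> Sinf Sv Sinj b; apply: contrapT => nF; apply: Sinf.
have bounded F k : S F -> leaf k \in F -> (k < b)%N.
  by move=> SF kF; rewrite ltnNge; apply/negP => bk; apply: nF; exists F, k.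
pose pat (F : seq tree) : {ffun 'I_b -> bool} := [ffun i : 'I_b => leaf i \in F].
have patinj : {in S &, injective pat}.
  move=> E F /set_mem SE /set_mem SF /ffunP EF; apply: Sinj => // -[k|c f mu].
    have [kb|bk] := ltnP k b.
      by have := EF (Ordinal kb); rewrite !ffunE.
    by apply/idP/idP => /bounded; [move=> /(_ SE)|move=> /(_ SF)];
      rewrite ltnNge bk.
  have := Sv _ SE; rewrite -(Sv _ SF) => /(congr1 (fun z => z (node c f mu))).
  by [].
by move: (inj_card_eq patinj); rewrite card_eq_le => /andP[_ /card_le_finite]; apply.
Qed.

(** If infinitely many node parts occur, a generator tells them apart.  Otherwise
    infinitely many of the sets share their node part [v]: a set with another node
    part is separated by a generator, and a set with node part [v] by a sparse
    sequence supported on fast growing leaves. *)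
Lemma twisted_dual_escape (S : set (seq tree)) :
  infinite_set S -> (forall F, S F -> uniq F) ->
  (forall E F, S E -> S F -> E =i F -> E = F) ->
  exists s : nat -> seq tree, (forall k, S (s k)) /\
    forall F, uniq F -> exists2 z, twisted z & exists n, forall k, (n <= k)%N ->
      xor_sum (s k) z != xor_sum F z.
Proof.
move=> Sinf Su Sinj.
have realize (s : nat -> seq tree) F (h : cube tree -> bool) n : xor_morph h ->
    (forall k, S (s k)) -> uniq F ->
    (forall k, (n <= k)%N -> h (node_part (s k)) != h (node_part F)) ->
    exists2 z, twisted z & exists n, forall k, (n <= k)%N ->
      xor_sum (s k) z != xor_sum F z.
  move=> hD sS uF hn.
  have [|z Tz zE] := @twisted_realize h (fun k => if k is k'.+1 then s k' else F) hD.
    by case=> // k; exact: Su.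
  by exists z => //; exists n => k /hn; rewrite -(zE k.+1) -(zE 0).
have [NPfin|NPinf] := pselect (finite_set (node_part @` S)); last first.
  have [t [tS tE]] := xor_morph_escape (@cube_boolean tree) NPinf.
  have /choice[s sE] : forall k, exists F, S F /\ node_part F = t k.
    by move=> k; have [F] := tS k; exists F.
  have sS k : S (s k) := (sE k).1.
  exists s; split=> // F uF; have [h [hD [n hn]]] := tE (node_part F).
  by apply: (realize s F h n) => // k /hn; rewrite (sE k).2.
have [v Svinf] : exists v, infinite_set (S `&` [set F | node_part F = v]).
  apply: contrapT => nv; apply: Sinf.
  apply: (@sub_finite_set _ _ (\bigcup_(v in node_part @` S)
      (S `&` [set F | node_part F = v]))).
    by move=> F SF; exists (node_part F); [exists F|].
  by apply: bigcup_finite => // v _; apply: contrapT => vinf; apply: nv; exists v.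
have /choice[next nextP] : forall b, exists Fk : seq tree * nat,
    [/\ S Fk.1, node_part Fk.1 = v, leaf Fk.2 \in Fk.1 & (b <= Fk.2)%N].
  move=> b; have [||F [k [[SF Fv] kF bk]]] := @unbounded_leaves _ v Svinf _ _ b.
  - by move=> F [].
  - by move=> E F [SE _] [SF _]; exact: Sinj.
  by exists (F, k).
have [bnd bndP] := choice leaf_bound.
(* [lo k] is a lower bound imposed on the leaf [p k]: it exceeds the leaves of
   the earlier sets and makes the sequence [p] sparse. *)
pose fix lo k := if k is k'.+1 then maxn (2 ^ k'.+1) (bnd (next (lo k')).1) else 1%N.
pose s k := (next (lo k)).1; pose p k := (next (lo k)).2.
have sS k : S (s k) by have [] := nextP (lo k).
have sv k : node_part (s k) = v by have [] := nextP (lo k).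
have ps k : leaf (p k) \in s k by have [] := nextP (lo k).
have lo_p k : (lo k <= p k)%N by have [] := nextP (lo k).
have lo_ge k : (2 ^ k <= lo k)%N by case: k => //= k; rewrite leq_maxl.
have s_lo k i : leaf i \in s k -> (i < lo k.+1)%N.
  by move=> /bndP /leq_trans -> //=; rewrite leq_maxr.
exists s; split=> // F uF.
have [Fv|Fv] := pselect (node_part F = v); last first.
  have [x xv] : exists x, v x != node_part F x.
    apply: contrapT => nx; apply: Fv; apply: funext => x.
    by apply/eqP; rewrite eq_sym; apply/negPn/negP => xv; apply: nx; exists x.
  by apply: (realize s F (fun z => z x) 0) => // k _; rewrite sv.
have p_ge k : (2 ^ k <= p k)%N by rewrite (leq_trans (lo_ge k)).
have lo_mono : {homo lo : i j / (i <= j)%N}.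
  apply: homo_leq => //; first exact: leq_trans.
  move=> k; rewrite (leq_trans (lo_p k))//.
  by rewrite ltnW// s_lo.
have [m [mp ms]] : exists m : nat -> bool,
    (forall i, m i -> exists2 k, (bnd F <= k)%N & i = p k) /\
    (forall k, (bnd F <= k)%N -> leaf_sum (s k) m).
  apply: (@triangular_solution p (fun k => lo k.+1) (fun k => leaf_sum (s k))).
  - by move=> k; exact: leaf_sumD.
  - by move=> k m m' mm'; apply: leaf_sum_eq => i /s_lo /mm'.
  - by move=> k; apply: leaf_sum_mass => //; exact: Su.
  - by move=> k; exact: s_lo.
  - by move=> k; exact: lo_p.
exists (base_part m).
  exists m, [::]; split; last by rewrite /free_part big_nil addr0.
  by exists 1%N; apply: (sparse_support p_ge) => i /mp[k _ ->]; exists k.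
exists (bnd F) => k nk; rewrite !xor_sum_leaf ms//.
rewrite (@node_part_sum_eq (s k) F) ?sv ?Fv//; last exact: Su.
have -> : leaf_sum F m = leaf_sum F 0.
  apply: leaf_sum_eq => i /bndP iF; rewrite -[RHS]/false; apply/negP => /mp[j Fj ij].
  move: iF; rewrite ij ltnNge (leq_trans Fj)// (leq_trans _ (p_ge j))//.
  by rewrite ltnW// ltn_expl.
rewrite (xor_morph0 _ (leaf_sumD F)); first by case: (\big[addb/false]_(_ <- _ | _) _).
by move=> z; apply: funext => x; exact: addbb.
Qed.

(** * The first category and the theorem *)

Lemma exp2_dominates c a : exists n, (c * n.+1 + a < 2 ^ n)%N.
Proof.
(* Then [2 ^ (2 * k) = (2 ^ k) ^ 2] is at least [k.+1 ^ 2]. *)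
pose k := (2 * c + a)%N; exists (2 * k)%N.
have kk : (k.+1 ^ 2 <= 2 ^ (2 * k))%N.
  by rewrite mulnC expnM leq_exp2r// ltn_expl.
apply: leq_trans kk; rewrite /k -mulnn; nia.
Qed.

Definition leaf_sparse (c : nat) : set (cube tree) :=
  [set z | sparse_bound c (fun k => z (leaf k))].

Lemma twisted_leaf_sparse z : twisted z -> exists c, leaf_sparse c z.
Proof.
move=> [m [l [[c mc] ->]]]; exists c => n.
by rewrite (@eq_count _ _ m) => [|k]; [exact: mc|exact: twisted_leaf].
Qed.

(** Any finite set of coordinates leaves almost all of a long initial segment of
    leaves free; putting ones there breaks the bound. *)
Lemma leaf_sparse_thin c (L : seq tree) : exists (M : seq tree) (w : cube tree),
  forall z : cube tree, (forall x, x \in M -> x \notin L -> z x = w x) ->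
    ~ leaf_sparse c z.
Proof.
have [n cn] := exp2_dominates c (size L).
exists [seq leaf k | k <- iota 0 (2 ^ n)], (fun=> true) => z zE /(_ n).
apply/negP; rewrite -ltnNge -(ltn_add2r (size L)); apply: leq_trans cn _.
rewrite -[X in (X <= _)%N](size_iota 0).
rewrite -(count_predC (fun k => leaf k \in L)) addnC leq_add ?count_leaf_le//.
rewrite -!size_filter; apply: uniq_leq_size; first exact/filter_uniq/iota_uniq.
move=> k; rewrite !mem_filter => /andP[/= kL kn].
by rewrite kn andbT zE//; exact: map_f.
Qed.

Theorem theorem3p9 (R : realType) :
  exists G : topologicalZmodType,
    [/\ precompact_group G, reflexive_group R G & first_category G].
Proof.
exists (cube_subgroup twisted0 twistedD); split.
- exact/subcube_precompact/twisted_dense.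
- apply: boolean_reflexive.
  + exact: subcube_boolean.
  + exact/subcube_compact_finite/twisted_escape.
  + exact/subcube_dual_compact_finite/twisted_dual_escape.
  + exact: subcube_separated.
  + exact: subcube_linear_nbhs.
- apply: (subcube_first_category _ _ twisted_dense twisted_leaf_sparse).
  exact: leaf_sparse_thin.
Qed.
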